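(* (i) Let $a\neq 0$, $A$, $B$ be real constants with $A^2+B^2=1$, let $I\subset\mathbb{R}$ be an open interval and let $\theta:I\to\mathbb{R}$ be a smooth function. Define $\alpha=(x,y,z):I\to\mathbb{R}^3$ by (writing $\theta=\theta(s)$) $$x(s)=\frac{1}{\sqrt{1+a^2}}\Big(\sqrt{1+a^2}\,\cos\theta\,\sin\Big[\tfrac{\sqrt{1+a^2}}{a}\theta\Big]\Big(B\cos\Big[\tfrac{\sin\theta}{a}\Big]-A\sin\Big[\tfrac{\sin\theta}{a}\Big]\Big)-\cos\Big[\tfrac{\sqrt{1+a^2}}{a}\theta\Big]\Big(\cos\Big[\tfrac{\sin\theta}{a}\Big](A+aB\sin\theta)+(B-aA\sin\theta)\sin\Big[\tfrac{\sin\theta}{a}\Big]\Big)\Big),$$ $$y(s)=-\frac{1}{\sqrt{1+a^2}}\Big(\sqrt{1+a^2}\,\cos\theta\,\cos\Big[\tfrac{\sqrt{1+a^2}}{a}\theta\Big]\Big(B\cos\Big[\tfrac{\sin\theta}{a}\Big]-A\sin\Big[\tfrac{\sin\theta}{a}\Big]\Big)+\sin\Big[\tfrac{\sqrt{1+a^2}}{a}\theta\Big]\Big(\cos\Big[\tfrac{\sin\theta}{a}\Big](A+aB\sin\theta)+(B-aA\sin\theta)\sin\Big[\tfrac{\sin\theta}{a}\Big]\Big)\Big),$$ $$z(s)=\frac{1}{\sqrt{1+a^2}}\Big(\cos\Big[\tfrac{\sin\theta}{a}\Big](-aA+B\sin\theta)-\sin\Big[\tfrac{\sin\theta}{a}\Big](aB+A\sin\theta)\Big).$$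 If $\alpha$ is a regular curve (i.e. $\alpha'(s)\neq 0$ for all $s\in I$), then $\alpha$ is a spherical slant helix. (ii) Conversely, every spherical slant helix is, up to a rotation of $\mathbb{R}^3$ about the origin, of the form given in (i) for some constants $a\neq 0$, $A$, $B$ with $A^2+B^2=1$ and some smooth function $\theta$.
   Context: All curves are smooth maps from an open interval to $\mathbb{R}^3$. For a regular curve $\alpha$ put $\nu=\|\alpha'\|$, $\kappa=\|\alpha'\wedge\alpha''\|/\|\alpha'\|^3$, $T=\alpha'/\|\alpha'\|$ and, when $\kappa\neq0$, $B=\frac{\alpha'\wedge\alpha''}{\|\alpha'\wedge\alpha''\|}$ and $N=B\wedge T$ (principal normal). A regular curve with $\kappa(s)\neq 0$ for all $s$ is a slant helix if its principal normal $N$ makes a constant angle with a fixed direction (the axis), i.e. there is a fixed unit vector $\vec a$ with $\langle N(s),\vec a\rangle$ constant. Convention: the constant angle is not a right angle, i.e. there is a fixed unit vector $\vec a$ for which the constant $\langle N,\vec a\rangle$ is nonzero (it has the form $a/\sqrt{1+a^2}$ with a real constant $a\neq 0$). A spherical slant helix is a slant helix contained in the unit sphere $S^2\subset\mathbb{R}^3$ centered at the origin. *)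

(* Defs.v *)
From Stdlib Require Import Reals.
From Coquelicot Require Import Coquelicot.

Open Scope R_scope.

(** * Euclidean 3-space *)

Record vec3 : Type := V3 { vx : R; vy : R; vz : R }.

Definition vzero : vec3 := V3 0 0 0.

Definition vscale (c : R) (u : vec3) : vec3 :=
  V3 (c * vx u) (c * vy u) (c * vz u).

Definition dot (u v : vec3) : R := vx u * vx v + vy u * vy v + vz u * vz v.

Definition vnorm (u : vec3) : R := sqrt (dot u u).

Definition cross (u v : vec3) : vec3 :=
  V3 (vy u * vz v - vz u * vy v)
     (vz u * vx v - vx u * vz v)
     (vx u * vy v - vy u * vx v).

(** A real 3x3 matrix, given by its rows. *)
Record mat3 : Type := M3 { row1 : vec3; row2 : vec3; row3 : vec3 }.

Definition mulmv (M : mat3) (u : vec3) : vec3 :=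
  V3 (dot (row1 M) u) (dot (row2 M) u) (dot (row3 M) u).

(** The triple product expands to the usual 3x3 determinant. *)
Definition det3 (M : mat3) : R := dot (row1 M) (cross (row2 M) (row3 M)).

(** The six row equations say [M * M^T = 1]. *)
Definition is_orthogonal (M : mat3) : Prop :=
  dot (row1 M) (row1 M) = 1 /\
  dot (row2 M) (row2 M) = 1 /\
  dot (row3 M) (row3 M) = 1 /\
  dot (row1 M) (row2 M) = 0 /\
  dot (row1 M) (row3 M) = 0 /\
  dot (row2 M) (row3 M) = 0.

Definition is_rotation (M : mat3) : Prop := is_orthogonal M /\ det3 M = 1.

(** * Curves on an open interval

    Functions and curves are total on [R]; only their values on the interval
    [ooint lo hi] matter.  Since the interval is open, Coquelicot's total
    derivatives at its points depend only on those values. *)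

Definition ooint (lo hi : Rbar) (s : R) : Prop := Rbar_lt lo s /\ Rbar_lt s hi.

Definition smooth_on (lo hi : Rbar) (f : R -> R) : Prop :=
  forall (n : nat) (s : R), ooint lo hi s -> ex_derive_n f n s.

Definition smooth_curve_on (lo hi : Rbar) (alpha : R -> vec3) : Prop :=
  smooth_on lo hi (fun s => vx (alpha s)) /\
  smooth_on lo hi (fun s => vy (alpha s)) /\
  smooth_on lo hi (fun s => vz (alpha s)).

Definition vDerive (alpha : R -> vec3) (s : R) : vec3 :=
  V3 (Derive (fun t => vx (alpha t)) s)
     (Derive (fun t => vy (alpha t)) s)
     (Derive (fun t => vz (alpha t)) s).

Definition regular_on (lo hi : Rbar) (alpha : R -> vec3) : Prop :=
  forall s : R, ooint lo hi s -> vDerive alpha s <> vzero.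

Definition speed (alpha : R -> vec3) (s : R) : R := vnorm (vDerive alpha s).

Definition vel_cross_acc (alpha : R -> vec3) (s : R) : vec3 :=
  cross (vDerive alpha s) (vDerive (vDerive alpha) s).

Definition curvature (alpha : R -> vec3) (s : R) : R :=
  vnorm (vel_cross_acc alpha s) / speed alpha s ^ 3.

Definition tangent (alpha : R -> vec3) (s : R) : vec3 :=
  vscale (/ speed alpha s) (vDerive alpha s).

Definition binormal (alpha : R -> vec3) (s : R) : vec3 :=
  vscale (/ vnorm (vel_cross_acc alpha s)) (vel_cross_acc alpha s).

Definition normal (alpha : R -> vec3) (s : R) : vec3 :=
  cross (binormal alpha s) (tangent alpha s).

(** * Slant helices *)

(** [c <> 0] is the convention that the constant angle between the principal
    normal and the axis is not a right angle. *)
Definition is_slant_helix (lo hi : Rbar) (alpha : R -> vec3) : Prop :=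
  smooth_curve_on lo hi alpha /\
  regular_on lo hi alpha /\
  (forall s : R, ooint lo hi s -> curvature alpha s <> 0) /\
  exists (axis : vec3) (c : R),
    vnorm axis = 1 /\ c <> 0 /\
    forall s : R, ooint lo hi s -> dot (normal alpha s) axis = c.

Definition is_spherical_slant_helix (lo hi : Rbar) (alpha : R -> vec3) : Prop :=
  is_slant_helix lo hi alpha /\
  forall s : R, ooint lo hi s -> vnorm (alpha s) = 1.

Definition helix_x (a A B th : R) : R :=
  1 / sqrt (1 + a ^ 2) *
  (sqrt (1 + a ^ 2) * cos th * sin (sqrt (1 + a ^ 2) / a * th) *
     (B * cos (sin th / a) - A * sin (sin th / a))
   - cos (sqrt (1 + a ^ 2) / a * th) *
     (cos (sin th / a) * (A + a * B * sin th)
      + (B - a * A * sin th) * sin (sin th / a))).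

Definition helix_y (a A B th : R) : R :=
  - (1 / sqrt (1 + a ^ 2)) *
  (sqrt (1 + a ^ 2) * cos th * cos (sqrt (1 + a ^ 2) / a * th) *
     (B * cos (sin th / a) - A * sin (sin th / a))
   + sin (sqrt (1 + a ^ 2) / a * th) *
     (cos (sin th / a) * (A + a * B * sin th)
      + (B - a * A * sin th) * sin (sin th / a))).

Definition helix_z (a A B th : R) : R :=
  1 / sqrt (1 + a ^ 2) *
  (cos (sin th / a) * (- (a * A) + B * sin th)
   - sin (sin th / a) * (a * B + A * sin th)).

Definition helix_curve (a A B : R) (theta : R -> R) (s : R) : vec3 :=
  V3 (helix_x a A B (theta s)) (helix_y a A B (theta s)) (helix_z a A B (theta s)).

(* Main.v *)
(** For the curve of (i), with [p = A cos phi + B sin phi] and [phi = sin theta / a],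
    the velocity is [theta' p sin theta / a] times a unit vector [U], and
    [dU/dtheta = (sin theta / a) N] where [N] is unit and makes the constant angle
    [a / sqrt (1 + a^2)] with the z-axis.  Hence the principal normal is [N] up to the
    sign of [p], which does not vanish on the interval.

    Conversely let [e] be the axis and [<N, e> = c].  The Frenet equations give
    [<e, T>' = kappa nu c <> 0], so [<e, T>^2 + <e, B>^2 = 1 - c^2] is positive, and
    [<N, e>' = 0] shows that [<e, T>] vanishes wherever [<e, B>] does; hence [<e, B>]
    never vanishes.  Replacing [e] by [-e] makes it positive, so the angle [theta] of
    [(-<e, T>, <e, B>)] can be taken smoothly in (0, pi), as an arc cosine.  The part of
    [N] orthogonal to [e] rotates about [e] with angular speed [theta' / c], which yields a
    constant orthonormal frame, the rows of the rotation.  Finally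
    [(-<alpha, N>, <alpha, B>)] is a unit vector rotating at the rate
    [(<e, B> / c)'], so its initial phase provides the constants [A] and [B]. *)

Require Import Defs.
From Stdlib Require Import Reals Lra Psatz Ranalysis5.
From Coquelicot Require Import Coquelicot.

Open Scope R_scope.

(** * Smooth functions on an open interval *)

Lemma ooint_locally (lo hi : Rbar) (s : R) :
  ooint lo hi s -> locally s (ooint lo hi).
Proof.
  intros [H1 H2].
  apply filter_and; [apply (open_Rbar_gt lo) | apply (open_Rbar_lt hi)]; assumption.
Qed.

Lemma ooint_convex (lo hi : Rbar) (s t x : R) :
  ooint lo hi s -> ooint lo hi t -> s <= x <= t -> ooint lo hi x.
Proof.
  intros [H1 _] [_ H4] [H5 H6]; split.
  - apply Rbar_lt_le_trans with s; [exact H1 | exact H5].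
  - apply Rbar_le_lt_trans with t; [exact H6 | exact H4].
Qed.

Lemma ooint_inhabited (lo hi : Rbar) :
  Rbar_lt lo hi -> exists s : R, ooint lo hi s.
Proof.
  unfold ooint; destruct lo as [l| |], hi as [h| |]; simpl; intros H; try easy.
  - exists ((l + h) / 2); lra.
  - exists (l + 1); lra.
  - exists (h - 1); lra.
  - exists 0; easy.
Qed.

Lemma is_derive_zero_const (lo hi : Rbar) (f : R -> R) :
  (forall s, ooint lo hi s -> is_derive f s 0) ->
  forall s t, ooint lo hi s -> ooint lo hi t -> f s = f t.
Proof.
  intros Hf.
  assert (Hlt : forall s t, ooint lo hi s -> ooint lo hi t -> s < t -> f s = f t).
  { intros s t Hs Ht Hst; apply (eq_is_derive f s t); [|exact Hst].
    intros x Hx; apply Hf, (ooint_convex lo hi s t); assumption. }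
  intros s t Hs Ht; destruct (Rtotal_order s t) as [H|[H|H]].
  - auto.
  - now rewrite H.
  - symmetry; auto.
Qed.

(** An interval is connected, so the intermediate value theorem excludes two values of opposite
    sign. It fixes the sign of [p] for the explicit curves, and that of [<e, B>] in the converse. *)
Lemma nonvanishing_sign (lo hi : Rbar) (f : R -> R) :
  (forall s, ooint lo hi s -> ex_derive f s) ->
  (forall s, ooint lo hi s -> f s <> 0) ->
  (forall s, ooint lo hi s -> 0 < f s) \/ (forall s, ooint lo hi s -> f s < 0).
Proof.
  intros Hd Hn.
  assert (Hc : forall s, ooint lo hi s -> continuity_pt f s).
  { intros s Hs; apply continuity_pt_filterlim.
    now apply (ex_derive_continuous (K := R_AbsRing) f), Hd. }
  assert (Hno : forall s t, ooint lo hi s -> ooint lo hi t ->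
                            f s < 0 -> 0 < f t -> False).
  { intros s t Hs Ht H1 H2; destruct (Rtotal_order s t) as [H|[H|H]].
    - destruct (IVT_interv f s t) as [z [Hz Hz0]]; auto.
      + intros x Hx; apply Hc, (ooint_convex lo hi s t); auto.
      + apply (Hn z); auto; apply (ooint_convex lo hi s t); auto.
    - subst; lra.
    - destruct (IVT_interv (fun x => - f x) t s) as [z [Hz Hz0]]; try lra.
      + intros x Hx; apply continuity_pt_opp, Hc, (ooint_convex lo hi t s); auto.
      + apply (Hn z); [apply (ooint_convex lo hi t s); auto | lra]. }
  destruct (Classical_Prop.classic (exists s, ooint lo hi s /\ f s < 0)) as [[s [Hs H]]|H].
  - right; intros t Ht; destruct (Rtotal_order (f t) 0) as [H1|[H1|H1]]; auto.
    + now destruct (Hn t).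
    + now destruct (Hno s t).
  - left; intros t Ht; destruct (Rtotal_order (f t) 0) as [H1|[H1|H1]]; auto.
    + destruct H; eauto.
    + now destruct (Hn t).
Qed.

(** Differentiability of order [n] with the derivative peeled off on the inside, next to [f].
    Closure under an operation then follows by induction on [n] from its differentiation rule
    alone. *)
Fixpoint diff_on (lo hi : Rbar) (n : nat) (f : R -> R) : Prop :=
  match n with
  | O => True
  | S n => (forall s, ooint lo hi s -> ex_derive f s) /\ diff_on lo hi n (Derive f)
  end.

Lemma smooth_onE (lo hi : Rbar) (f : R -> R) :
  smooth_on lo hi f <-> forall n, diff_on lo hi n f.
Proof.
  assert (E : forall g n x, Derive_n (Derive g) n x = Derive_n g (S n) x).
  { intros g n x; rewrite <- PeanoNat.Nat.add_1_r; exact (Derive_n_comp g n 1 x). }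
  split; intros H.
  - intros n; revert f H; induction n as [|n IH]; intros f H; [exact I|].
    split; [exact (H 1%nat)|].
    (* Order 0 of [ex_derive_n] is [True]; order [k + 1] for [Derive f] is order [k + 2] for [f]. *)
    apply IH; intros [|k] s Hs; [exact I|].
    apply (ex_derive_ext (Derive_n f (S k))); [|exact (H (S (S k)) s Hs)].
    now intros t; rewrite E.
  - intros n; specialize (H n); revert f H; induction n as [|n IH]; intros f H s Hs.
    + exact I.
    + destruct H as [H1 H2]; destruct n as [|n]; [now apply H1|].
      apply (ex_derive_ext (Derive_n (Derive f) n)); [intros t; apply E|].
      now apply (IH (Derive f)).
Qed.

(** * Closure properties of differentiability of finite order *)

Section SmoothOps.
Variables lo hi : Rbar.
Notation I := (ooint lo hi).
Notation Dn := (diff_on lo hi).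

Lemma diff_on_ext n f g : (forall s, I s -> f s = g s) -> Dn n f -> Dn n g.
Proof.
  revert f g; induction n as [|n IH]; intros f g E; [easy|]; intros [H1 H2].
  assert (L : forall s, I s -> locally s (fun t => f t = g t)).
  { intros s Hs; apply (filter_imp I); [exact E | now apply ooint_locally]. }
  split.
  - intros s Hs; apply (ex_derive_ext_loc f); auto.
  - apply (IH (Derive f)); auto; intros s Hs; apply Derive_ext_loc; auto.
Qed.

Lemma diff_on_S n f f' :
  (forall s, I s -> is_derive f s (f' s)) -> Dn n f' -> Dn (S n) f.
Proof.
  intros H1 H2; split.
  - intros s Hs; exists (f' s); auto.
  - apply (diff_on_ext n f'); auto; intros s Hs; symmetry.
    apply is_derive_unique; auto.
Qed.

Lemma diff_on_is_derive n f s : Dn (S n) f -> I s -> is_derive f s (Derive f s).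
Proof. intros [H _] Hs; apply Derive_correct; auto. Qed.

Lemma diff_on_pred n f : Dn (S n) f -> Dn n f.
Proof.
  revert f; induction n as [|n IH]; intros f; [easy|].
  intros [H1 H2]; split; auto.
Qed.

Lemma diff_on_const n c : Dn n (fun _ => c).
Proof.
  revert c; induction n as [|n IH]; intros c; [easy|].
  apply (diff_on_S n _ (fun _ => 0)); auto.
  intros s _; apply (is_derive_const c).
Qed.

Lemma diff_on_plus n f g : Dn n f -> Dn n g -> Dn n (fun s => f s + g s).
Proof.
  revert f g; induction n as [|n IH]; intros f g Hf Hg; [easy|].
  apply (diff_on_S n _ (fun s => Derive f s + Derive g s)).
  - intros s Hs.
    apply @is_derive_plus; apply (diff_on_is_derive n); auto.
  - apply IH; [apply Hf | apply Hg].
Qed.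

Lemma diff_on_mult n f g : Dn n f -> Dn n g -> Dn n (fun s => f s * g s).
Proof.
  revert f g; induction n as [|n IH]; intros f g Hf Hg; [easy|].
  apply (diff_on_S n _ (fun s => Derive f s * g s + f s * Derive g s)).
  - intros s Hs.
    apply (is_derive_mult f g); try (apply (diff_on_is_derive n); auto).
    intros; apply Rmult_comm.
  - apply diff_on_plus; apply IH; solve [apply diff_on_pred; assumption | apply Hf | apply Hg].
Qed.

(** Sine and cosine go through one induction because the derivative of each contains the other. *)
Lemma diff_on_sin_cos n f :
  Dn n f -> Dn n (fun s => sin (f s)) /\ Dn n (fun s => cos (f s)).
Proof.
  revert f; induction n as [|n IH]; intros f Hf; [easy|].
  destruct (IH f (diff_on_pred n f Hf)) as [Hs Hc].
  split.
  - apply (diff_on_S n _ (fun s => Derive f s * cos (f s))).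
    + intros s Is; apply (is_derive_comp sin f); [apply is_derive_sin|].
      now apply (diff_on_is_derive n).
    + apply diff_on_mult; [apply Hf | exact Hc].
  - apply (diff_on_S n _ (fun s => Derive f s * (-1 * sin (f s)))).
    + intros s Is; replace (-1 * sin (f s)) with (- sin (f s)) by ring.
      apply (is_derive_comp cos f); [apply is_derive_cos|].
      now apply (diff_on_is_derive n).
    + apply diff_on_mult; [apply Hf|]; apply diff_on_mult; [apply diff_on_const | exact Hs].
Qed.

Lemma diff_on_sin n f : Dn n f -> Dn n (fun s => sin (f s)).
Proof. intros H; apply (diff_on_sin_cos n f H). Qed.

Lemma diff_on_cos n f : Dn n f -> Dn n (fun s => cos (f s)).
Proof. intros H; apply (diff_on_sin_cos n f H). Qed.

Lemma diff_on_opp n f : Dn n f -> Dn n (fun s => - f s).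
Proof.
  intros H; apply (diff_on_ext n (fun s => -1 * f s)); [intros; ring|].
  apply diff_on_mult; [apply diff_on_const | exact H].
Qed.

(** The derivative of [/ f] is built from [Derive f] and [/ f] itself, to which the induction
    hypothesis applies at the lower order. *)
Lemma diff_on_inv n f :
  (forall s, I s -> f s <> 0) -> Dn n f -> Dn n (fun s => / f s).
Proof.
  intros H0; induction n as [|n IH]; intros Hf; [easy|].
  apply (diff_on_S n _ (fun s => -1 * Derive f s * (/ f s * / f s))).
  - intros s Hs.
    replace (-1 * Derive f s * (/ f s * / f s)) with (- Derive f s / f s ^ 2)
      by (field; auto).
    apply is_derive_inv; [now apply (diff_on_is_derive n) | auto].
  - pose proof (IH (diff_on_pred n f Hf)).
    repeat apply diff_on_mult; auto; [apply diff_on_const | apply Hf].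
Qed.

Lemma diff_on_sqrt n f :
  (forall s, I s -> 0 < f s) -> Dn n f -> Dn n (fun s => sqrt (f s)).
Proof.
  intros H0; induction n as [|n IH]; intros Hf; [easy|].
  apply (diff_on_S n _ (fun s => Derive f s * / (2 * sqrt (f s)))).
  - intros s Hs; apply (is_derive_comp sqrt f).
    + apply is_derive_Reals, derivable_pt_lim_sqrt; auto.
    + now apply (diff_on_is_derive n).
  - apply diff_on_mult; [apply Hf|].
    apply diff_on_inv.
    + intros s Hs; pose proof (sqrt_lt_R0 _ (H0 s Hs)); lra.
    + apply diff_on_mult; [apply diff_on_const | apply IH, diff_on_pred, Hf].
Qed.

Lemma is_derive_acos x :
  -1 < x < 1 -> is_derive acos x (-1 * / sqrt (1 - x * x)).
Proof.
  intros Hx; apply is_derive_Reals.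
  apply (derive_pt_eq_1 acos x _ (derivable_pt_acos x Hx)).
  rewrite derive_pt_acos; reflexivity.
Qed.

(** One differentiation leaves only a product, an inverse and a square root, so the earlier closure
    lemmas finish without induction. The strict bounds keep the radicand positive. *)
Lemma diff_on_acos n f :
  (forall s, I s -> -1 < f s < 1) -> Dn n f -> Dn n (fun s => acos (f s)).
Proof.
  intros H0; destruct n as [|n]; intros Hf; [easy|].
  apply (diff_on_S n _ (fun s => Derive f s * (-1 * / sqrt (1 + -1 * (f s * f s))))).
  - intros s Hs.
    replace (1 + -1 * (f s * f s)) with (1 - f s * f s) by ring.
    apply (is_derive_comp acos f); [now apply is_derive_acos, H0|].
    now apply (diff_on_is_derive n).
  - assert (H1 : forall s, I s -> 0 < 1 + -1 * (f s * f s)).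
    { intros s Hs; specialize (H0 s Hs); nra. }
    apply diff_on_pred in Hf as Hf'.
    apply diff_on_mult; [apply Hf|]; apply diff_on_mult; [apply diff_on_const|].
    apply diff_on_inv.
    + intros s Hs; pose proof (sqrt_lt_R0 _ (H1 s Hs)); lra.
    + apply diff_on_sqrt; auto; apply diff_on_plus; [apply diff_on_const|].
      apply diff_on_mult; [apply diff_on_const | now apply diff_on_mult].
Qed.

End SmoothOps.

Lemma smooth_on_is_derive (lo hi : Rbar) (f : R -> R) (s : R) :
  smooth_on lo hi f -> ooint lo hi s -> is_derive f s (Derive f s).
Proof. intros H Hs; apply Derive_correct, (H 1%nat s Hs). Qed.

Lemma smooth_on_Derive (lo hi : Rbar) (f : R -> R) :
  smooth_on lo hi f -> smooth_on lo hi (Derive f).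
Proof.
  rewrite !smooth_onE; intros H n; exact (proj2 (H (S n))).
Qed.

(** * Vectors and frames *)

Definition vadd (u v : vec3) : vec3 := V3 (vx u + vx v) (vy u + vy v) (vz u + vz v).

Lemma vec3_eq (u v : vec3) : vx u = vx v -> vy u = vy v -> vz u = vz v -> u = v.
Proof. destruct u, v; simpl; intros; subst; reflexivity. Qed.

Ltac vec_ring :=
  intros; try apply vec3_eq; unfold dot, cross, vscale, vadd, vzero; simpl; ring.

Lemma dot_comm u v : dot u v = dot v u.
Proof. vec_ring. Qed.

Lemma dot_vadd_l u v w : dot (vadd u v) w = dot u w + dot v w.
Proof. vec_ring. Qed.

Lemma dot_vadd_r u v w : dot w (vadd u v) = dot w u + dot w v.
Proof. vec_ring. Qed.

Lemma dot_vscale_l c u v : dot (vscale c u) v = c * dot u v.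
Proof. vec_ring. Qed.

Lemma dot_vscale_r c u v : dot u (vscale c v) = c * dot u v.
Proof. vec_ring. Qed.

Lemma dot_cross_self_l u v : dot u (cross u v) = 0.
Proof. vec_ring. Qed.

Lemma dot_cross_self_r u v : dot v (cross u v) = 0.
Proof. vec_ring. Qed.

Lemma dot_cross_assoc u v w : dot (cross u v) w = dot u (cross v w).
Proof. vec_ring. Qed.

Lemma cross_cross_r u v w :
  cross u (cross v w) = vadd (vscale (dot u w) v) (vscale (- dot u v) w).
Proof. vec_ring. Qed.

Lemma cross_cross_l u v w :
  cross (cross u v) w = vadd (vscale (dot u w) v) (vscale (- dot v w) u).
Proof. vec_ring. Qed.

Lemma lagrange_identity u v :
  dot (cross u v) (cross u v) = dot u u * dot v v - dot u v ^ 2.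
Proof. vec_ring. Qed.

Lemma dot_self_ge0 u : 0 <= dot u u.
Proof. unfold dot; nra. Qed.

Lemma dot_self_eq0 u : dot u u = 0 -> u = vzero.
Proof.
  destruct u as [x y z]; unfold dot, vzero; simpl; intros H.
  assert (x = 0) by nra; assert (y = 0) by nra; assert (z = 0) by nra; congruence.
Qed.

Lemma dot_self_gt0 u : u <> vzero -> 0 < dot u u.
Proof.
  intros H; destruct (dot_self_ge0 u) as [H1|H1]; [exact H1|].
  destruct H; apply dot_self_eq0; auto.
Qed.

Lemma vnorm_sqr u : vnorm u * vnorm u = dot u u.
Proof. apply sqrt_sqrt, dot_self_ge0. Qed.

Lemma vnorm_eq1 u : vnorm u = 1 -> dot u u = 1.
Proof. intros H; rewrite <- vnorm_sqr, H; ring. Qed.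

Lemma vnorm_unit u : dot u u = 1 -> vnorm u = 1.
Proof. intros H; unfold vnorm; rewrite H; apply sqrt_1. Qed.

(** * Oriented orthonormal frames *)

Definition oriented_frame (T N B : vec3) : Prop :=
  (dot T T = 1 /\ dot N N = 1 /\ dot B B = 1) /\
  (dot T N = 0 /\ dot T B = 0 /\ dot N B = 0) /\
  (cross N B = T /\ cross B T = N /\ cross T N = B).

(** The middle vector is [cross B T], as in the definition of [normal]; the remaining relations come
    from the Lagrange identity and the double cross product. *)
Lemma oriented_frame_intro (T B : vec3) :
  dot T T = 1 -> dot B B = 1 -> dot T B = 0 -> oriented_frame T (cross B T) B.
Proof.
  intros HT HB HTB.
  assert (HBT : dot B T = 0) by now rewrite dot_comm.
  repeat split; auto.
  - rewrite lagrange_identity, HT, HB, HBT; ring.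
  - apply dot_cross_self_r.
  - rewrite dot_comm; apply dot_cross_self_l.
  - rewrite cross_cross_l, HB, HTB; vec_ring.
  - rewrite cross_cross_r, HT, HTB; vec_ring.
Qed.

(* A vector orthogonal to the frame is orthogonal and, by the double cross
   product, parallel to [B = T x N]. *)
Lemma frame_separates (T N B z : vec3) :
  oriented_frame T N B -> dot z T = 0 -> dot z N = 0 -> dot z B = 0 -> z = vzero.
Proof.
  intros ((_ & _ & HB) & _ & (_ & _ & HTN)) H1 H2 H3.
  assert (Hc : cross z B = vzero).
  { rewrite <- HTN, cross_cross_r, H1, H2; vec_ring. }
  apply dot_self_eq0.
  pose proof (lagrange_identity z B) as L.
  rewrite Hc, HB, H3 in L; unfold dot at 1 in L; simpl in L; lra.
Qed.

(** The difference between [z] and the right-hand side is orthogonal to all three frame vectors,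
    hence zero. *)
Lemma frame_expand (T N B z : vec3) :
  oriented_frame T N B ->
  z = vadd (vscale (dot z T) T) (vadd (vscale (dot z N) N) (vscale (dot z B) B)).
Proof.
  intros H.
  set (y := vadd _ _).
  assert (Hz : vadd z (vscale (-1) y) = vzero).
  { pose proof H as ((TT & NN & BB) & (TN & TB & NB) & _).
    assert (NT : dot N T = 0) by now rewrite dot_comm.
    assert (BT : dot B T = 0) by now rewrite dot_comm.
    assert (BN : dot B N = 0) by now rewrite dot_comm.
    apply (frame_separates T N B); auto; unfold y;
      rewrite !dot_vadd_l, !dot_vscale_l, !dot_vadd_l, !dot_vscale_l,
        ?TT, ?NN, ?BB, ?TN, ?TB, ?NB, ?NT, ?BT, ?BN; ring. }
  clearbody y; destruct z, y; unfold vadd, vscale, vzero in Hz; simpl in Hz.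
  injection Hz; intros; f_equal; lra.
Qed.

Lemma frame_dot (T N B y z : vec3) :
  oriented_frame T N B ->
  dot y z = dot y T * dot z T + dot y N * dot z N + dot y B * dot z B.
Proof.
  intros H; rewrite (frame_expand T N B z H) at 1.
  rewrite !dot_vadd_r, !dot_vscale_r; ring.
Qed.

(** * Differentiation of vector-valued functions *)

Definition is_vderive (F : R -> vec3) (s : R) (l : vec3) : Prop :=
  is_derive (fun t => vx (F t)) s (vx l) /\
  is_derive (fun t => vy (F t)) s (vy l) /\
  is_derive (fun t => vz (F t)) s (vz l).

Lemma is_vderive_vDerive F s l : is_vderive F s l -> vDerive F s = l.
Proof.
  intros (H1 & H2 & H3); apply vec3_eq; simpl; apply is_derive_unique; assumption.
Qed.

Lemma is_vderive_ext_loc F G s l :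
  locally s (fun t => F t = G t) -> is_vderive F s l -> is_vderive G s l.
Proof.
  intros H (H1 & H2 & H3); split; [|split].
  - apply (is_derive_ext_loc (fun t => vx (F t))); auto.
    apply (filter_imp _ _ (fun t E => f_equal vx E) H).
  - apply (is_derive_ext_loc (fun t => vy (F t))); auto.
    apply (filter_imp _ _ (fun t E => f_equal vy E) H).
  - apply (is_derive_ext_loc (fun t => vz (F t))); auto.
    apply (filter_imp _ _ (fun t E => f_equal vz E) H).
Qed.

Lemma is_derive_Rmult (f g : R -> R) (s f1 g1 : R) :
  is_derive f s f1 -> is_derive g s g1 ->
  is_derive (fun t => f t * g t) s (f1 * g s + f s * g1).
Proof. intros Hf Hg; apply (is_derive_mult f g); auto; intros; apply Rmult_comm. Qed.

Lemma is_derive_eq (f : R -> R) (s l l' : R) :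
  is_derive f s l -> l = l' -> is_derive f s l'.
Proof. intros H E; rewrite <- E; exact H. Qed.

Lemma is_vderive_eq F s l l' : is_vderive F s l -> l = l' -> is_vderive F s l'.
Proof. intros H E; rewrite <- E; exact H. Qed.

Lemma is_derive_dot F G s F1 G1 :
  is_vderive F s F1 -> is_vderive G s G1 ->
  is_derive (fun t => dot (F t) (G t)) s (dot F1 (G s) + dot (F s) G1).
Proof.
  intros (HF1 & HF2 & HF3) (HG1 & HG2 & HG3); unfold dot.
  eapply is_derive_eq.
  - apply @is_derive_plus; [apply @is_derive_plus|]; apply is_derive_Rmult; eassumption.
  - unfold plus; simpl; ring.
Qed.

Lemma is_vderive_vscale f F s f1 F1 :
  is_derive f s f1 -> is_vderive F s F1 ->
  is_vderive (fun t => vscale (f t) (F t)) s (vadd (vscale f1 (F s)) (vscale (f s) F1)).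
Proof.
  intros Hf (HF1 & HF2 & HF3); unfold vscale; split; [|split]; simpl;
    apply is_derive_Rmult; assumption.
Qed.

Lemma is_vderive_vadd F G s F1 G1 :
  is_vderive F s F1 -> is_vderive G s G1 ->
  is_vderive (fun t => vadd (F t) (G t)) s (vadd F1 G1).
Proof.
  intros (HF1 & HF2 & HF3) (HG1 & HG2 & HG3); unfold vadd; split; [|split]; simpl;
    apply @is_derive_plus; assumption.
Qed.

Lemma is_vderive_cross F G s F1 G1 :
  is_vderive F s F1 -> is_vderive G s G1 ->
  is_vderive (fun t => cross (F t) (G t)) s (vadd (cross F1 (G s)) (cross (F s) G1)).
Proof.
  intros (HF1 & HF2 & HF3) (HG1 & HG2 & HG3); unfold cross; split; [|split]; simpl;
    (eapply is_derive_eq;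
     [apply @is_derive_minus; apply is_derive_Rmult; eassumption
     | unfold minus, plus, opp; simpl; ring]).
Qed.

Lemma is_vderive_const v s : is_vderive (fun _ => v) s vzero.
Proof. split; [|split]; apply @is_derive_const. Qed.

(** The value of the derivative may stay unknown: when a normalized vector is differentiated, it
    only multiplies [F s], which is orthogonal to the vectors that the result is paired with. *)
Lemma is_derive_inv_norm F s F1 :
  is_vderive F s F1 -> F s <> vzero -> exists l, is_derive (fun t => / vnorm (F t)) s l.
Proof.
  intros HF H0.
  assert (H1 : 0 < dot (F s) (F s)) by now apply dot_self_gt0.
  eexists; apply is_derive_inv.
  - apply (is_derive_comp sqrt (fun t => dot (F t) (F t))).
    + apply is_derive_Reals, derivable_pt_lim_sqrt; exact H1.
    + apply is_derive_dot; eassumption.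
  - pose proof (sqrt_lt_R0 _ H1); unfold vnorm; lra.
Qed.

Lemma dot_const_derive (lo hi : Rbar) F G s F1 G1 c :
  (forall t, ooint lo hi t -> dot (F t) (G t) = c) -> ooint lo hi s ->
  is_vderive F s F1 -> is_vderive G s G1 -> dot F1 (G s) + dot (F s) G1 = 0.
Proof.
  intros Hc Hs HF HG.
  rewrite <- (is_derive_unique _ _ _ (is_derive_dot F G s F1 G1 HF HG)).
  rewrite (Derive_ext_loc _ (fun _ => c)); [apply Derive_const|].
  apply (filter_imp (ooint lo hi)); [exact Hc | now apply ooint_locally].
Qed.

Lemma is_vderive_zero_const (lo hi : Rbar) (F : R -> vec3) :
  (forall s, ooint lo hi s -> is_vderive F s vzero) ->
  forall s t, ooint lo hi s -> ooint lo hi t -> F s = F t.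
Proof.
  intros H s t Hs Ht; apply vec3_eq;
    [ apply (is_derive_zero_const lo hi (fun x => vx (F x)))
    | apply (is_derive_zero_const lo hi (fun x => vy (F x)))
    | apply (is_derive_zero_const lo hi (fun x => vz (F x))) ];
    auto; intros x Hx; apply (H x Hx).
Qed.

(** Differentiating the six constant inner products shows that the coefficients of the derivatives
    in the frame form a skew-symmetric matrix. With [dot T1 (B s) = 0] it has the Frenet shape. *)
Lemma frame_equations (lo hi : Rbar) (T N B : R -> vec3) (s : R) (T1 N1 B1 : vec3) :
  (forall t, ooint lo hi t -> oriented_frame (T t) (N t) (B t)) -> ooint lo hi s ->
  is_vderive T s T1 -> is_vderive N s N1 -> is_vderive B s B1 -> dot T1 (B s) = 0 ->
  T1 = vscale (dot T1 (N s)) (N s) /\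
  N1 = vadd (vscale (- dot T1 (N s)) (T s)) (vscale (dot N1 (B s)) (B s)) /\
  B1 = vscale (- dot N1 (B s)) (N s).
Proof.
  intros HF Hs HT HN HB HTB.
  pose proof (HF s Hs) as Fs.
  assert (TT := dot_const_derive lo hi T T s T1 T1 1
                  (fun t Ht => proj1 (proj1 (HF t Ht))) Hs HT HT).
  assert (NN := dot_const_derive lo hi N N s N1 N1 1
                  (fun t Ht => proj1 (proj2 (proj1 (HF t Ht)))) Hs HN HN).
  assert (BB := dot_const_derive lo hi B B s B1 B1 1
                  (fun t Ht => proj2 (proj2 (proj1 (HF t Ht)))) Hs HB HB).
  assert (TN := dot_const_derive lo hi T N s T1 N1 0
                  (fun t Ht => proj1 (proj1 (proj2 (HF t Ht)))) Hs HT HN).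
  assert (TB := dot_const_derive lo hi T B s T1 B1 0
                  (fun t Ht => proj1 (proj2 (proj1 (proj2 (HF t Ht))))) Hs HT HB).
  assert (NB := dot_const_derive lo hi N B s N1 B1 0
                  (fun t Ht => proj2 (proj2 (proj1 (proj2 (HF t Ht))))) Hs HN HB).
  rewrite (dot_comm (T s)) in TT, TN, TB.
  rewrite (dot_comm (N s)) in NN, NB.
  rewrite (dot_comm (B s)) in BB.
  split; [|split].
  - rewrite (frame_expand _ _ _ T1 Fs) at 1.
    replace (dot T1 (T s)) with 0 by lra; rewrite HTB; vec_ring.
  - rewrite (frame_expand _ _ _ N1 Fs) at 1.
    replace (dot N1 (T s)) with (- dot T1 (N s)) by lra.
    replace (dot N1 (N s)) with 0 by lra; vec_ring.
  - rewrite (frame_expand _ _ _ B1 Fs) at 1.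
    replace (dot B1 (T s)) with 0 by lra.
    replace (dot B1 (N s)) with (- dot N1 (B s)) by lra.
    replace (dot B1 (B s)) with 0 by lra; vec_ring.
Qed.

Lemma smooth_curve_is_vderive lo hi alpha s :
  smooth_curve_on lo hi alpha -> ooint lo hi s -> is_vderive alpha s (vDerive alpha s).
Proof.
  intros (H1 & H2 & H3) Hs; split; [|split]; apply (smooth_on_is_derive lo hi); auto.
Qed.

Lemma smooth_curve_vDerive lo hi alpha :
  smooth_curve_on lo hi alpha -> smooth_curve_on lo hi (vDerive alpha).
Proof.
  intros (H1 & H2 & H3); split; [|split].
  - exact (smooth_on_Derive lo hi _ H1).
  - exact (smooth_on_Derive lo hi _ H2).
  - exact (smooth_on_Derive lo hi _ H3).
Qed.

Lemma vscale_inv_norm_unit v :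
  v <> vzero -> dot (vscale (/ vnorm v) v) (vscale (/ vnorm v) v) = 1.
Proof.
  intros Hv; rewrite dot_vscale_l, dot_vscale_r, <- vnorm_sqr.
  assert (0 < vnorm v) by now apply sqrt_lt_R0, dot_self_gt0.
  field; lra.
Qed.

(** * Frenet frame *)

Section Frenet.
Variables (lo hi : Rbar) (alpha : R -> vec3).
Hypothesis Hsm : smooth_curve_on lo hi alpha.
Hypothesis Hreg : regular_on lo hi alpha.
Hypothesis Hcurv : forall s, ooint lo hi s -> curvature alpha s <> 0.

Lemma vel_cross_acc_neq0 s : ooint lo hi s -> vel_cross_acc alpha s <> vzero.
Proof.
  intros Hs H; apply (Hcurv s Hs); unfold curvature, vnorm; rewrite H.
  replace (dot vzero vzero) with 0 by vec_ring.
  rewrite sqrt_0; apply Rmult_0_l.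
Qed.

Lemma frenet_frame s :
  ooint lo hi s -> oriented_frame (tangent alpha s) (normal alpha s) (binormal alpha s).
Proof.
  intros Hs; apply oriented_frame_intro.
  - apply vscale_inv_norm_unit, Hreg, Hs.
  - apply vscale_inv_norm_unit, vel_cross_acc_neq0, Hs.
  - unfold tangent, binormal, vel_cross_acc.
    rewrite dot_vscale_l, dot_vscale_r, dot_cross_self_l; ring.
Qed.

Lemma velocity_tangent s :
  ooint lo hi s -> vDerive alpha s = vscale (speed alpha s) (tangent alpha s) /\
                   0 < speed alpha s.
Proof.
  intros Hs.
  assert (0 < speed alpha s) by now apply sqrt_lt_R0, dot_self_gt0, Hreg.
  split; auto; unfold tangent; apply vec3_eq; simpl; field; lra.
Qed.

(** Here [m] is curvature times speed and [t] is torsion times speed. Only the sign of [m] is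
    recorded. *)
Lemma frenet_equations s :
  ooint lo hi s -> exists m t : R, 0 < m /\
    is_vderive (tangent alpha) s (vscale m (normal alpha s)) /\
    is_vderive (normal alpha) s
      (vadd (vscale (- m) (tangent alpha s)) (vscale t (binormal alpha s))) /\
    is_vderive (binormal alpha) s (vscale (- t) (normal alpha s)).
Proof.
  intros Hs.
  pose proof (smooth_curve_vDerive _ _ _ Hsm) as Hsm1.
  pose proof (smooth_curve_vDerive _ _ _ Hsm1) as Hsm2.
  pose proof (smooth_curve_is_vderive _ _ _ s Hsm1 Hs) as D1.
  pose proof (smooth_curve_is_vderive _ _ _ s Hsm2 Hs) as D2.
  pose proof (vel_cross_acc_neq0 s Hs) as Hw.
  pose proof (is_vderive_cross _ _ _ _ _ D1 D2) as Dw.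
  destruct (is_derive_inv_norm _ _ _ D1 (Hreg s Hs)) as [l1 Hl1].
  destruct (is_derive_inv_norm _ _ _ Dw Hw) as [l2 Hl2].
  pose proof (is_vderive_vscale _ _ _ _ _ Hl1 D1) as DT.
  pose proof (is_vderive_vscale _ _ _ _ _ Hl2 Dw) as DB.
  pose proof (is_vderive_cross _ _ _ _ _ DB DT) as DN.
  match type of DT with is_vderive _ _ ?x => set (T1 := x) in * end.
  match type of DB with is_vderive _ _ ?x => set (B1 := x) in * end.
  match type of DN with is_vderive _ _ ?x => set (N1 := x) in * end.
  (* [T1] is a combination of velocity and acceleration, and both are orthogonal to their cross
     product. *)
  assert (HT1 : dot T1 (binormal alpha s) = 0).
  { unfold T1, binormal, vel_cross_acc.
    rewrite dot_vadd_l, !dot_vscale_l, !dot_vscale_r, dot_cross_self_l, dot_cross_self_r.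
    ring. }
  destruct (frame_equations lo hi (tangent alpha) (normal alpha) (binormal alpha)
              s T1 N1 B1 frenet_frame Hs DT DN DB HT1) as (E1 & E2 & E3).
  exists (dot T1 (normal alpha s)), (dot N1 (binormal alpha s)).
  split; [|split; [|split]].
  - unfold T1, normal, binormal, tangent.
    set (v := vDerive alpha s) in *; set (a := vDerive (vDerive alpha) s) in *.
    set (w := vel_cross_acc alpha s).
    assert (H1 : 0 < vnorm v) by (apply sqrt_lt_R0, dot_self_gt0, Hreg, Hs).
    assert (H2 : 0 < vnorm w) by (apply sqrt_lt_R0, dot_self_gt0, Hw).
    (* As [w] is [cross v a], a cyclic shift of the triple product gives the squared norm of [w].
       This makes [m] positive. *)
    assert (Hwv : dot a (cross w v) = dot w w).
    { rewrite dot_comm, dot_cross_assoc; reflexivity. }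
    match goal with |- 0 < ?x => replace x with
      (/ vnorm v * / vnorm v * / vnorm w * dot a (cross w v)
       + l1 * / speed alpha s * / vnorm w * dot v (cross w v)) end.
    + rewrite dot_cross_self_r, Hwv, Rmult_0_r, Rplus_0_r.
      repeat apply Rmult_lt_0_compat; try apply Rinv_0_lt_compat; auto.
      apply dot_self_gt0, Hw.
    + unfold speed; fold v; vec_ring.
  - now rewrite E1 in DT.
  - now rewrite E2 in DN.
  - now rewrite E3 in DB.
Qed.

(** The angle [theta] of the converse is an arc cosine of a multiple of [<e, T>], so its smoothness
    rests on that of the tangent. *)
Lemma tangent_smooth : smooth_curve_on lo hi (tangent alpha).
Proof.
  destruct (smooth_curve_vDerive _ _ _ Hsm) as (H1 & H2 & H3).
  assert (Hi : smooth_on lo hi (fun s => / speed alpha s)).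
  { rewrite smooth_onE in H1, H2, H3 |- *; intros n.
    apply diff_on_inv.
    - intros s Hs; destruct (velocity_tangent s Hs); lra.
    - apply diff_on_sqrt.
      + intros s Hs; apply dot_self_gt0, Hreg, Hs.
      + unfold dot; repeat apply diff_on_plus; apply diff_on_mult; auto. }
  rewrite smooth_onE in H1, H2, H3, Hi.
  split; [|split]; apply smooth_onE; intros n; apply diff_on_mult; auto.
Qed.

End Frenet.

(** * The explicit curve in terms of a moving frame *)

Lemma cos2_eq t : cos t ^ 2 = 1 - sin t ^ 2.
Proof. pose proof (sin2_cos2 t); unfold Rsqr in *; lra. Qed.

Lemma sqrt_1_sqr_gt0 a : 0 < sqrt (1 + a ^ 2).
Proof. apply sqrt_lt_R0; nra. Qed.

Lemma sqrt_1_sqr_sqr a : sqrt (1 + a ^ 2) ^ 2 = 1 + a ^ 2.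
Proof. apply pow2_sqrt; nra. Qed.

(** With [helix_q], the vector [(A, B)] rotated by the angle [- sin th / a]. *)
Definition helix_p (a A B th : R) : R := A * cos (sin th / a) + B * sin (sin th / a).
Definition helix_q (a A B th : R) : R := B * cos (sin th / a) - A * sin (sin th / a).

Lemma helix_pq_sqr a A B th :
  A ^ 2 + B ^ 2 = 1 -> helix_p a A B th ^ 2 + helix_q a A B th ^ 2 = 1.
Proof.
  intros H; unfold helix_p, helix_q; rewrite <- H.
  ring [(cos2_eq (sin th / a))].
Qed.

(** This is [- p N + q (U x N)] with [U = helix_tangent a th] and [N = helix_normal a th]. Keeping
    [p] and [q] free lets the same formula describe the coordinates of an arbitrary spherical slant
    helix. *)
Definition helix_point (a p q th : R) : vec3 :=
  let k := sqrt (1 + a ^ 2) in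
  V3 (cos th * sin (k / a * th) * q - / k * cos (k / a * th) * (p + a * sin th * q))
     (- (cos th * cos (k / a * th) * q + / k * sin (k / a * th) * (p + a * sin th * q)))
     (/ k * (- a * p + sin th * q)).

Lemma helix_curveE a A B theta s :
  helix_curve a A B theta s =
  helix_point a (helix_p a A B (theta s)) (helix_q a A B (theta s)) (theta s).
Proof.
  pose proof (sqrt_1_sqr_gt0 a) as Hk.
  unfold helix_curve, helix_point, helix_x, helix_y, helix_z, helix_p, helix_q.
  set (ps := sqrt (1 + a ^ 2) / a * theta s).
  set (ph := sin (theta s) / a).
  apply vec3_eq; cbn [vx vy vz]; field; lra.
Qed.

Definition helix_tangent (a th : R) : vec3 :=
  let k := sqrt (1 + a ^ 2) in
  V3 (a / k * (cos (k / a * th) * cos th) + sin (k / a * th) * sin th)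
     (a / k * (sin (k / a * th) * cos th) - cos (k / a * th) * sin th)
     (- cos th / k).

Definition helix_normal (a th : R) : vec3 :=
  let k := sqrt (1 + a ^ 2) in
  V3 (cos (k / a * th) / k) (sin (k / a * th) / k) (a / k).

(** * The curves of the explicit family *)

Section HelixCurve.
Variable a : R.
Hypothesis Ha : a <> 0.
Let k := sqrt (1 + a ^ 2).

Lemma helix_point_unit p q th :
  p ^ 2 + q ^ 2 = 1 -> dot (helix_point a p q th) (helix_point a p q th) = 1.
Proof.
  intros Hpq.
  pose proof (sqrt_1_sqr_gt0 a) as Hk; pose proof (sqrt_1_sqr_sqr a) as Hk2.
  unfold dot, helix_point; cbn [vx vy vz]; fold k in Hk, Hk2 |- *.
  assert (Hp : p ^ 2 = 1 - q ^ 2) by lra.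
  assert (Ik : (/ k) ^ 2 * (1 + a ^ 2) = 1) by (rewrite <- Hk2; field; lra).
  set (ps := k / a * th).
  (* The angle [ps] disappears through [cos2_eq], and the mixed terms in [p] and [q] of the
     horizontal and vertical parts cancel. *)
  transitivity (cos th ^ 2 * q ^ 2 + (/ k) ^ 2 * (1 + a ^ 2) * (p ^ 2 + sin th ^ 2 * q ^ 2)).
  - ring [(cos2_eq ps)].
  - rewrite Ik; ring [Hp (cos2_eq th)].
Qed.

Lemma helix_frame_unit th :
  dot (helix_tangent a th) (helix_tangent a th) = 1 /\
  dot (helix_normal a th) (helix_normal a th) = 1 /\
  dot (helix_tangent a th) (helix_normal a th) = 0.
Proof.
  pose proof (sqrt_1_sqr_gt0 a) as Hk; pose proof (sqrt_1_sqr_sqr a) as Hk2.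
  unfold dot, helix_tangent, helix_normal; cbn [vx vy vz].
  fold k in Hk, Hk2 |- *.
  assert (Ik : (/ k) ^ 2 * (1 + a ^ 2) = 1) by (rewrite <- Hk2; field; lra).
  set (ps := k / a * th); unfold Rdiv.
  split; [|split].
  - transitivity (sin th ^ 2 + (/ k) ^ 2 * (1 + a ^ 2) * cos th ^ 2).
    + ring [(cos2_eq ps)].
    + rewrite Ik; ring [(cos2_eq th)].
  - rewrite <- Ik; ring [(cos2_eq ps)].
  - ring [(cos2_eq ps)].
Qed.

(** Differentiation is in [th], where [p' = q cos th / a] and [q' = - p cos th / a]; the chain rule
    brings in [theta] later. *)
Lemma is_vderive_helix_point A B th :
  is_vderive (fun t => helix_point a (helix_p a A B t) (helix_q a A B t) t) th
    (vscale (helix_p a A B th * sin th / a) (helix_tangent a th)).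
Proof.
  pose proof (sqrt_1_sqr_gt0 a) as Hk; pose proof (sqrt_1_sqr_sqr a) as Hk2.
  fold k in Hk, Hk2.
  split; [|split]; unfold helix_point, helix_tangent, helix_p, helix_q, vscale;
    cbn [vx vy vz]; fold k; unfold Rdiv; auto_derive; auto; field [Hk2 (cos2_eq th)]; lra.
Qed.

Lemma is_vderive_helix_tangent th :
  is_vderive (helix_tangent a) th (vscale (sin th / a) (helix_normal a th)).
Proof.
  pose proof (sqrt_1_sqr_gt0 a) as Hk; pose proof (sqrt_1_sqr_sqr a) as Hk2.
  fold k in Hk, Hk2.
  split; [|split]; unfold helix_tangent, helix_normal, vscale;
    cbn [vx vy vz]; fold k; unfold Rdiv; auto_derive; auto; field [Hk2 (cos2_eq th)]; lra.
Qed.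

End HelixCurve.

Lemma is_vderive_comp (F : R -> vec3) (f : R -> R) s l f1 :
  is_vderive F (f s) l -> is_derive f s f1 ->
  is_vderive (fun t => F (f t)) s (vscale f1 l).
Proof.
  intros (H1 & H2 & H3) Hf; split; [|split]; simpl.
  - apply (is_derive_comp (fun t => vx (F t)) f); auto.
  - apply (is_derive_comp (fun t => vy (F t)) f); auto.
  - apply (is_derive_comp (fun t => vz (F t)) f); auto.
Qed.

Lemma vnorm_vscale c u : vnorm (vscale c u) = Rabs c * vnorm u.
Proof.
  unfold vnorm; rewrite dot_vscale_l, dot_vscale_r, <- Rmult_assoc.
  rewrite sqrt_mult by (try apply dot_self_ge0; apply Rle_0_sqr).
  now rewrite <- (sqrt_Rsqr_abs c).
Qed.

(** The tangential part [h] drops out of the cross product, so [B] is the sign of [f g] times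
    [U x N], while [T] is the sign of [f] times [U]. The sign of [f] enters [cross B T] twice, and
    only that of [g] survives. *)
Lemma curvature_normal_of_frame alpha s U N f g h :
  dot U U = 1 -> dot N N = 1 -> dot U N = 0 -> f <> 0 -> g <> 0 ->
  vDerive alpha s = vscale f U ->
  vDerive (vDerive alpha) s = vadd (vscale h U) (vscale g N) ->
  curvature alpha s <> 0 /\ normal alpha s = vscale (g / Rabs g) N.
Proof.
  intros HU HN HUN Hf Hg Hv Ha.
  pose proof (Rabs_pos_lt f Hf) as Pf; pose proof (Rabs_pos_lt g Hg) as Pg.
  assert (Hw : vel_cross_acc alpha s = vscale (f * g) (cross U N)).
  { unfold vel_cross_acc; rewrite Hv, Ha; vec_ring. }
  assert (Hwn : vnorm (vel_cross_acc alpha s) = Rabs f * Rabs g).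
  { rewrite Hw, vnorm_vscale, Rabs_mult, (vnorm_unit (cross U N)); [ring|].
    rewrite lagrange_identity, HU, HN, HUN; ring. }
  assert (Hs : speed alpha s = Rabs f).
  { unfold speed; rewrite Hv, vnorm_vscale, (vnorm_unit U HU); ring. }
  split.
  - unfold curvature; rewrite Hwn, Hs.
    apply Rgt_not_eq, Rdiv_lt_0_compat; [apply Rmult_lt_0_compat | apply pow_lt]; auto.
  - unfold normal, binormal, tangent; rewrite Hwn, Hs, Hw, Hv.
    assert (Hc : cross (cross U N) U = N).
    { rewrite cross_cross_l, HU, (dot_comm N U), HUN; vec_ring. }
    transitivity (vscale (/ (Rabs f * Rabs g) * (f * g) * (/ Rabs f * f)) (cross (cross U N) U)).
    + vec_ring.
    + rewrite Hc; f_equal.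
      assert (Hff : f * f = Rabs f * Rabs f) by (rewrite <- Rabs_mult, Rabs_pos_eq; nra).
      replace (/ (Rabs f * Rabs g) * (f * g) * (/ Rabs f * f))
        with (f * f * g * / (Rabs f * Rabs f * Rabs g)) by (field; lra).
      rewrite Hff; field; lra.
Qed.

Lemma helix_smooth lo hi a A B theta :
  smooth_on lo hi theta -> smooth_curve_on lo hi (helix_curve a A B theta).
Proof.
  intros H; split; [|split]; rewrite smooth_onE in H |- *; intros n; specialize (H n);
    unfold helix_curve, helix_x, helix_y, helix_z, Rdiv, Rminus; simpl;
    repeat first [ exact H | apply diff_on_const | apply diff_on_opp | apply diff_on_plus
                 | apply diff_on_mult | apply diff_on_sin | apply diff_on_cos ].
Qed.

Lemma helix_is_spherical_slant_helix (lo hi : Rbar) (a A B : R) (theta : R -> R) :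
  Rbar_lt lo hi -> a <> 0 -> A ^ 2 + B ^ 2 = 1 -> smooth_on lo hi theta ->
  regular_on lo hi (helix_curve a A B theta) ->
  is_spherical_slant_helix lo hi (helix_curve a A B theta).
Proof.
  intros Hlt Ha HAB Hth Hreg.
  pose proof (sqrt_1_sqr_gt0 a) as Hk.
  set (p := fun s => helix_p a A B (theta s)).
  (* [f] is the signed speed along [helix_tangent], and [g] is the component of the acceleration
     along [helix_normal]. *)
  set (f := fun s => Derive theta s * (p s * sin (theta s) / a)).
  set (g := fun s => f s * (Derive theta s * (sin (theta s) / a))).
  assert (Dth : forall s, ooint lo hi s -> is_derive theta s (Derive theta s)).
  { intros s Hs; now apply (smooth_on_is_derive lo hi). }
  assert (Dv : forall s, ooint lo hi s ->
    vDerive (helix_curve a A B theta) s = vscale (f s) (helix_tangent a (theta s))).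
  { intros s Hs; apply is_vderive_vDerive.
    apply (is_vderive_ext_loc (fun s => helix_point a (helix_p a A B (theta s))
                                 (helix_q a A B (theta s)) (theta s))).
    - apply filter_forall; intros t; symmetry; apply helix_curveE.
    - eapply is_vderive_eq.
      + apply (is_vderive_comp (fun t => helix_point a (helix_p a A B t) (helix_q a A B t) t)).
        * now apply is_vderive_helix_point.
        * now apply Dth.
      + unfold f, p; vec_ring. }
  assert (Hf0 : forall s, ooint lo hi s -> f s <> 0).
  { intros s Hs E; apply (Hreg s Hs); rewrite (Dv s Hs), E; vec_ring. }
  (* Regularity makes the product [f] nonzero, hence each of its factors. *)
  assert (Hfac : forall s, ooint lo hi s ->
            Derive theta s <> 0 /\ p s <> 0 /\ sin (theta s) <> 0).
  { intros s Hs; specialize (Hf0 s Hs); unfold f, Rdiv in Hf0.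
    repeat split; intros E; apply Hf0; rewrite E; ring. }
  assert (Dp : forall s, ooint lo hi s -> ex_derive p s).
  { intros s Hs; unfold p, helix_p; auto_derive; repeat split; eexists; now apply Dth. }
  assert (Df : forall s, ooint lo hi s -> ex_derive f s).
  { intros s Hs.
    apply (ex_derive_mult (Derive theta) (fun s => p s * sin (theta s) / a)).
    - eexists; apply (smooth_on_is_derive lo hi); auto; now apply smooth_on_Derive.
    - pose proof (Dp s Hs); auto_derive; repeat split; auto; eexists; now apply Dth. }
  assert (HN : forall s, ooint lo hi s ->
    curvature (helix_curve a A B theta) s <> 0 /\
    normal (helix_curve a A B theta) s =
      vscale (g s / Rabs (g s)) (helix_normal a (theta s))).
  { intros s Hs; destruct (helix_frame_unit a (theta s)) as (H1 & H2 & H3).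
    destruct (Hfac s Hs) as (F1 & F2 & F3).
    destruct (Df s Hs) as [h Hh].
    apply (curvature_normal_of_frame _ s (helix_tangent a (theta s)) _ (f s) (g s) h); auto.
    - repeat apply Rmult_integral_contrapositive_currified; auto; now apply Rinv_neq_0_compat.
    - apply is_vderive_vDerive.
      apply (is_vderive_ext_loc (fun s => vscale (f s) (helix_tangent a (theta s)))).
      + apply (filter_imp (ooint lo hi)); [|now apply ooint_locally].
        intros t Ht; symmetry; now apply Dv.
      + eapply is_vderive_eq.
        * apply is_vderive_vscale; [exact Hh|].
          apply (is_vderive_comp (helix_tangent a)); [|now apply Dth].
          now apply is_vderive_helix_tangent.
        * unfold g; vec_ring. }
  (* [g] is [p] times the square of [theta' sin theta / a], so the sign of the normal is the sign of
     [p]. *)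
  assert (Hg : forall s, ooint lo hi s ->
    exists d, 0 < d /\ g s = d * p s).
  { intros s Hs; destruct (Hfac s Hs) as (F1 & F2 & F3).
    exists ((Derive theta s * sin (theta s) / a) ^ 2); split.
    - apply pow2_gt_0; unfold Rdiv.
      repeat apply Rmult_integral_contrapositive_currified; auto; now apply Rinv_neq_0_compat.
    - unfold g, f; field; auto. }
  split; [split; [|split; [|split]]|].
  - now apply helix_smooth.
  - exact Hreg.
  - intros s Hs; apply (HN s Hs).
  (* The axis is vertical. The constant is [a / sqrt (1 + a ^ 2)] or its opposite according to the
     sign of [p], which is the same on the whole interval. *)
  - exists (V3 0 0 1).
    assert (Hp := nonvanishing_sign lo hi p Dp (fun s Hs => proj1 (proj2 (Hfac s Hs)))).
    assert (Hdot : forall s x, dot (vscale x (helix_normal a s)) (V3 0 0 1)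
                               = x * (a / sqrt (1 + a ^ 2))).
    { intros s x; rewrite dot_vscale_l; unfold dot, helix_normal; cbn [vx vy vz]; ring. }
    assert (Hc : a / sqrt (1 + a ^ 2) <> 0).
    { apply Rmult_integral_contrapositive_currified; auto; apply Rinv_neq_0_compat; lra. }
    destruct Hp as [Hp|Hp]; [exists (a / sqrt (1 + a ^ 2)) | exists (- (a / sqrt (1 + a ^ 2)))];
      (split; [apply vnorm_unit; unfold dot; simpl; ring | split; [lra|]]);
      intros s Hs; destruct (HN s Hs) as [_ E]; destruct (Hg s Hs) as (d & Hd & Eg);
      specialize (Hp s Hs); rewrite E, Hdot.
    + rewrite Rabs_pos_eq by nra; field; split; nra.
    + rewrite Rabs_left by nra; field; split; nra.
  - intros s _; rewrite helix_curveE; apply vnorm_unit, helix_point_unit.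
    now apply helix_pq_sqr.
Qed.

(** * Recovering the explicit form *)

Section SphericalSlantHelix.
Variables (lo hi : Rbar) (alpha T N B : R -> vec3) (e : vec3) (c : R).
Notation I := (ooint lo hi).
Hypothesis Hlohi : Rbar_lt lo hi.
Hypothesis Halpha : forall s, I s ->
  exists nu, nu <> 0 /\ is_vderive alpha s (vscale nu (T s)).
Hypothesis Hframe : forall s, I s -> oriented_frame (T s) (N s) (B s).
Hypothesis Hfrenet : forall s, I s -> exists m t : R, 0 < m /\
  is_vderive T s (vscale m (N s)) /\
  is_vderive N s (vadd (vscale (- m) (T s)) (vscale t (B s))) /\
  is_vderive B s (vscale (- t) (N s)).
Hypothesis HT : smooth_curve_on lo hi T.
Hypothesis Hsphere : forall s, I s -> dot (alpha s) (alpha s) = 1.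
Hypothesis He : dot e e = 1.
Hypothesis Hc : c <> 0.
Hypothesis HN : forall s, I s -> dot (N s) e = c.
Hypothesis Hb : forall s, I s -> 0 < dot e (B s).

Let u s := dot e (T s).
Let b s := dot e (B s).
(** [c], [r] and [a] are the cosine, sine and cotangent of the angle between [N] and [e]. *)
Let r := sqrt (1 - c ^ 2).
Let a := c / r.
(** Chosen so that the component of [T] along [e] is [- r cos theta], the vertical component of
    [helix_tangent]. *)
Let theta s := acos (- / r * u s).
Let p s := - dot (alpha s) (N s).
Let q s := dot (alpha s) (B s).
(** The normalized part of [N] orthogonal to [e], rotated back about [e] by the angle
    [theta / c]. *)
Let e1 s := vadd (vscale (cos (theta s / c) / r) (vadd (N s) (vscale (- c) e)))
                 (vscale (- (sin (theta s / c) / r)) (cross e (N s))).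
(** [Aof] and [Bof] undo the rotation in [helix_p] and [helix_q], whose angle [sin theta / a] equals
    [b / c]. *)
Let Aof s := p s * cos (b s / c) - q s * sin (b s / c).
Let Bof s := p s * sin (b s / c) + q s * cos (b s / c).

Lemma axis_components s : I s -> u s ^ 2 + c ^ 2 + b s ^ 2 = 1.
Proof.
  intros Hs; pose proof (frame_dot _ _ _ e e (Hframe s Hs)) as H.
  rewrite He, (dot_comm e (N s)), (HN s Hs) in H; unfold u, b; rewrite H; ring.
Qed.

(** At any one point of the nonempty interval, [1 - c ^ 2 = u ^ 2 + b ^ 2] with [b] positive. *)
Lemma axis_r : 0 < r /\ r ^ 2 = 1 - c ^ 2.
Proof.
  destruct (ooint_inhabited lo hi Hlohi) as [s Hs].
  pose proof (axis_components s Hs); pose proof (Hb s Hs) as H1; fold (b s) in H1.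
  split; [apply sqrt_lt_R0 | apply pow2_sqrt]; nra.
Qed.

Lemma axis_k : sqrt (1 + a ^ 2) = / r.
Proof.
  destruct axis_r as [H1 H2].
  rewrite <- (sqrt_Rsqr (/ r)) by (left; now apply Rinv_0_lt_compat).
  f_equal; unfold a, Rsqr.
  replace (1 + (c / r) ^ 2) with ((r ^ 2 + c ^ 2) * (/ r * / r)) by (field; lra).
  rewrite H2; ring.
Qed.

Lemma theta_range s : I s -> -1 < - / r * u s < 1.
Proof.
  intros Hs; destruct axis_r as [H1 H2].
  pose proof (axis_components s Hs); pose proof (Hb s Hs) as H3; fold (b s) in H3.
  assert (- r < u s < r) by (split; nra).
  assert (- / r * u s = - (u s / r)) by (field; lra).
  assert (u s / r < 1) by (apply Rmult_lt_reg_r with r; auto; field_simplify; lra).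
  assert (-1 < u s / r) by (apply Rmult_lt_reg_r with r; auto; field_simplify; lra).
  lra.
Qed.

(** This root is both the sine of [theta] and the denominator in the derivative of the arc
    cosine. *)
Lemma theta_sqrt s : I s -> sqrt (1 - (- / r * u s) * (- / r * u s)) = b s / r.
Proof.
  intros Hs; destruct axis_r as [H1 H2].
  pose proof (axis_components s Hs); pose proof (Hb s Hs) as H3; fold (b s) in H3.
  rewrite <- (sqrt_Rsqr (b s / r)) by (left; now apply Rdiv_lt_0_compat).
  f_equal; unfold Rsqr.
  replace (b s / r * (b s / r)) with ((r ^ 2 - u s ^ 2) / r ^ 2); [field; lra|].
  replace (r ^ 2 - u s ^ 2) with (b s ^ 2) by lra; field; lra.
Qed.

Lemma cos_theta s : I s -> cos (theta s) = - (u s / r).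
Proof.
  intros Hs; destruct axis_r as [H1 _]; pose proof (theta_range s Hs).
  unfold theta; rewrite cos_acos by lra; field; lra.
Qed.

Lemma sin_theta s : I s -> sin (theta s) = b s / r.
Proof.
  intros Hs; pose proof (theta_range s Hs).
  unfold theta; rewrite sin_acos by lra; now apply theta_sqrt.
Qed.

Lemma theta_smooth : smooth_on lo hi theta.
Proof.
  destruct HT as (H1 & H2 & H3); rewrite smooth_onE in H1, H2, H3 |- *; intros n.
  apply diff_on_acos; [exact theta_range|].
  apply diff_on_mult; [apply diff_on_const|]; unfold u, dot.
  repeat apply diff_on_plus; apply diff_on_mult; auto using diff_on_const.
Qed.

(** On the sphere, position and velocity are orthogonal, and the velocity is a nonzero multiple of
    [T]. *)
Lemma dot_alpha_T s : I s -> dot (alpha s) (T s) = 0.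
Proof.
  intros Hs; destruct (Halpha s Hs) as (nu & Hnu & DA).
  pose proof (dot_const_derive lo hi alpha alpha s _ _ 1 Hsphere Hs DA DA) as H.
  rewrite dot_vscale_l, dot_vscale_r, (dot_comm (T s)) in H.
  apply Rmult_eq_reg_l with (2 * nu); lra.
Qed.

Lemma cross_axis_N s :
  I s -> cross e (N s) = vadd (vscale (- b s) (T s)) (vscale (u s) (B s)).
Proof.
  intros Hs; pose proof (Hframe s Hs) as F.
  pose proof F as (_ & _ & (NB & BT & TN)).
  rewrite (frame_expand _ _ _ (cross e (N s)) F), !dot_cross_assoc, NB.
  replace (cross (N s) (T s)) with (vscale (-1) (B s)) by (rewrite <- TN; vec_ring).
  rewrite dot_vscale_r; fold (u s) (b s); vec_ring.
Qed.

(** All the rates are governed by [w], the angular speed of [N] about [e]; in particular [w u] is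
    the Frenet coefficient [t], the rate at which [(p, q)] rotates. *)
Lemma slant_derivatives s : I s -> exists w : R,
  is_derive theta s (c * w) /\
  is_vderive N s (vscale w (cross e (N s))) /\
  is_derive b s (- (c * (w * u s))) /\
  is_derive p s (w * u s * - q s) /\
  is_derive q s (w * u s * p s).
Proof.
  intros Hs; destruct axis_r as [Hr Hr2].
  pose proof (Hb s Hs) as Hbs; fold (b s) in Hbs.
  pose proof (Hframe s Hs) as F.
  destruct (Hfrenet s Hs) as (m & t & Hm & DT & DN & DB).
  destruct (Halpha s Hs) as (nu & Hnu & DA).
  assert (HeN : dot e (N s) = c) by (rewrite dot_comm; auto).
  (* Differentiating [<N, e> = c] gives [- m u + t b = 0]. *)
  assert (Ht : t = m / b s * u s).
  { pose proof (dot_const_derive lo hi N (fun _ => e) s _ _ c HN Hs DN (is_vderive_const e s)) as H.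
    rewrite dot_vadd_l, !dot_vscale_l, (dot_comm (T s)), (dot_comm (B s)) in H.
    fold (u s) (b s) in H.
    replace (dot (N s) vzero) with 0 in H by vec_ring.
    apply Rmult_eq_reg_r with (b s); [field_simplify|]; lra. }
  pose proof (dot_alpha_T s Hs) as HaT.
  exists (m / b s); split; [|split; [|split; [|split]]].
  - eapply is_derive_eq.
    + apply (is_derive_comp acos (fun s => - / r * u s)).
      * apply is_derive_acos, theta_range, Hs.
      * apply is_derive_scal, is_derive_dot; [apply is_vderive_const | exact DT].
    + rewrite (theta_sqrt s Hs), dot_vscale_r, HeN.
      replace (dot vzero (T s)) with 0 by vec_ring.
      unfold scal; simpl; unfold mult; simpl; field; lra.
  - apply (is_vderive_eq _ _ _ _ DN).
    rewrite (cross_axis_N s Hs), Ht.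
    apply vec3_eq; unfold vadd, vscale; cbn [vx vy vz]; field; lra.
  - eapply is_derive_eq.
    + apply is_derive_dot; [apply is_vderive_const | exact DB].
    + rewrite dot_vscale_r, HeN, Ht; replace (dot vzero (B s)) with 0 by vec_ring; ring.
  - eapply is_derive_eq.
    + apply @is_derive_opp, is_derive_dot; [exact DA | exact DN].
    + destruct F as (_ & (TN0 & _ & _) & _).
      rewrite dot_vscale_l, dot_vadd_r, !dot_vscale_r, TN0, HaT, Ht.
      unfold opp; simpl; unfold q; ring.
  - eapply is_derive_eq.
    + apply is_derive_dot; [exact DA | exact DB].
    + destruct F as (_ & (_ & TB0 & _) & _).
      rewrite dot_vscale_l, dot_vscale_r, TB0, Ht; unfold p; ring.
Qed.

(** [(p, q)] rotates at the rate [w u], and [b / c] has derivative [- w u]. Turning [(p, q)] by the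
    angle [b / c] therefore gives a fixed vector. *)
Lemma Aof_Bof_const s s0 : I s -> I s0 -> Aof s = Aof s0 /\ Bof s = Bof s0.
Proof.
  intros Hs Hs0.
  assert (Dcs : forall x w, is_derive b x (- (c * (w * u x))) ->
     is_derive (fun y => cos (b y / c)) x (w * u x * sin (b x / c)) /\
     is_derive (fun y => sin (b y / c)) x (- (w * u x * cos (b x / c)))).
  { intros x w Db; split.
    - eapply is_derive_eq.
      + apply (is_derive_comp cos (fun y => b y / c)); [apply is_derive_cos|].
        apply is_derive_Rmult; [exact Db | apply @is_derive_const].
      + unfold scal, zero; simpl; unfold mult; simpl; field; auto.
    - eapply is_derive_eq.
      + apply (is_derive_comp sin (fun y => b y / c)); [apply is_derive_sin|].
        apply is_derive_Rmult; [exact Db | apply @is_derive_const].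
      + unfold scal, zero; simpl; unfold mult; simpl; field; auto. }
  split; [apply (is_derive_zero_const lo hi Aof) | apply (is_derive_zero_const lo hi Bof)]; auto;
    intros x Hx; destruct (slant_derivatives x Hx) as (w & _ & _ & Db & Dp & Dq);
    destruct (Dcs x w Db) as [Dcos Dsin]; eapply is_derive_eq.
  - apply @is_derive_minus; apply is_derive_Rmult; eassumption.
  - unfold minus, plus, opp; simpl; ring.
  - apply @is_derive_plus; apply is_derive_Rmult; eassumption.
  - unfold plus; simpl; ring.
Qed.

(** [N] turns about [e] with angular speed [w], which is also the derivative of [theta / c], so the
    backward rotation compensates exactly. *)
Lemma e1_const s s0 : I s -> I s0 -> e1 s = e1 s0.
Proof.
  intros Hs Hs0; apply (is_vderive_zero_const lo hi e1); auto.
  intros x Hx; destruct axis_r as [Hr _].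
  destruct (slant_derivatives x Hx) as (w & Dth & DN & _).
  assert (Dps : is_derive (fun y => theta y / c) x w).
  { eapply is_derive_eq.
    - apply is_derive_Rmult; [exact Dth | apply @is_derive_const].
    - unfold zero; simpl; field; auto. }
  assert (Dcos : is_derive (fun y => cos (theta y / c) / r) x (- (w * sin (theta x / c) / r))).
  { eapply is_derive_eq.
    - apply is_derive_Rmult; [|apply @is_derive_const].
      apply (is_derive_comp cos (fun y => theta y / c)); [apply is_derive_cos | exact Dps].
    - unfold scal, zero; simpl; unfold mult; simpl; field; lra. }
  assert (Dsin : is_derive (fun y => - (sin (theta y / c) / r)) x (- (w * cos (theta x / c) / r))).
  { eapply is_derive_eq.
    - apply @is_derive_opp, is_derive_Rmult; [|apply @is_derive_const].
      apply (is_derive_comp sin (fun y => theta y / c)); [apply is_derive_sin | exact Dps].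
    - unfold scal, zero, opp; simpl; unfold mult; simpl; field; lra. }
  eapply is_vderive_eq.
  - apply is_vderive_vadd; apply is_vderive_vscale; [exact Dcos | | exact Dsin | ].
    + apply is_vderive_vadd; [exact DN | apply is_vderive_const].
    + apply is_vderive_cross; [apply is_vderive_const | exact DN].
  (* The double cross product turns the derivative of [e x N] into [w (c e - N)], after which the
     sine and cosine terms cancel in pairs. *)
  - cbv beta; replace (cross e (vscale w (cross e (N x))))
      with (vscale w (vadd (vscale c e) (vscale (-1) (N x)))).
    + apply vec3_eq; unfold vadd, vscale, vzero, cross; cbn [vx vy vz]; field; lra.
    + replace (cross e (vscale w (cross e (N x))))
        with (vscale w (cross e (cross e (N x)))) by vec_ring.
      rewrite cross_cross_r, He, (dot_comm e (N x)), (HN x Hx); vec_ring.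
Qed.

(** [N - c e] and [e x N] are orthogonal to each other and to [e], and both have length [r]. *)
Lemma e1_unit s : I s -> dot (e1 s) (e1 s) = 1 /\ dot (e1 s) e = 0.
Proof.
  intros Hs; destruct axis_r as [Hr Hr2].
  assert (NN : dot (N s) (N s) = 1) by apply (Hframe s Hs).
  assert (HeN : dot e (N s) = c) by (rewrite dot_comm; auto).
  assert (Hx : dot (cross e (N s)) (cross e (N s)) = r ^ 2).
  { rewrite lagrange_identity, He, NN, HeN; lra. }
  unfold e1; split.
  - rewrite ?dot_vadd_l, ?dot_vadd_r, ?dot_vscale_l, ?dot_vscale_r, ?dot_vadd_l, ?dot_vadd_r,
      ?dot_vscale_l, ?dot_vscale_r, (dot_comm (cross e (N s)) (N s)),
      (dot_comm (cross e (N s)) e), dot_cross_self_r, dot_cross_self_l, Hx, NN, He, HeN,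
      (HN s Hs).
    set (ps := theta s / c); unfold Rdiv.
    transitivity ((cos ps ^ 2 + sin ps ^ 2) * ((/ r) ^ 2 * r ^ 2)).
    + generalize (/ r); intros i; ring [Hr2].
    + rewrite cos2_eq; field; lra.
  - rewrite ?dot_vadd_l, ?dot_vscale_l, ?dot_vadd_l, ?dot_vscale_l,
      (dot_comm (cross e (N s)) e), dot_cross_self_l, He, (HN s Hs).
    ring.
Qed.

(** Since [<alpha, T> = 0], the position is [- p N + q B]; pairing it with [N], [e] and [e x N]
    determines all three coordinates. The vector [e1] is still taken at [s]. *)
Lemma alpha_coordinates s : I s ->
  V3 (dot (e1 s) (alpha s)) (dot (cross e (e1 s)) (alpha s)) (dot e (alpha s)) =
  helix_point a (p s) (q s) (theta s).
Proof.
  intros Hs; destruct axis_r as [Hr Hr2].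
  pose proof (Hframe s Hs) as F.
  pose proof (dot_alpha_T s Hs) as HaT.
  assert (HeN : dot e (N s) = c) by (rewrite dot_comm; auto).
  assert (HNa : dot (N s) (alpha s) = - p s) by (unfold p; rewrite dot_comm; ring).
  assert (Hea : dot e (alpha s) = - c * p s + b s * q s).
  { rewrite (frame_dot _ _ _ e (alpha s) F), HaT, HeN; unfold p, q, b; ring. }
  assert (HeNa : dot (cross e (N s)) (alpha s) = u s * q s).
  { rewrite (cross_axis_N s Hs), dot_vadd_l, !dot_vscale_l,
      (dot_comm (T s)), HaT, (dot_comm (B s)); unfold q; ring. }
  assert (Hee1 : cross e (e1 s) =
    vadd (vscale (cos (theta s / c) / r) (cross e (N s)))
         (vscale (- (sin (theta s / c) / r)) (vadd (vscale c e) (vscale (-1) (N s))))).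
  { transitivity (vadd (vscale (cos (theta s / c) / r) (cross e (N s)))
                       (vscale (- (sin (theta s / c) / r)) (cross e (cross e (N s))))).
    - unfold e1; vec_ring.
    - rewrite cross_cross_r, He, HeN; vec_ring. }
  rewrite Hee1; unfold e1, helix_point; rewrite axis_k.
  replace (/ r / a * theta s) with (theta s / c) by (unfold a; field; lra).
  rewrite (cos_theta s Hs), (sin_theta s Hs), Rinv_inv; unfold a.
  apply vec3_eq; cbn [vx vy vz];
    rewrite ?dot_vadd_l, ?dot_vscale_l, ?dot_vadd_l, ?dot_vscale_l, ?HNa, ?HeNa, ?Hea.
  - field [Hr2]; lra.
  - field [Hr2]; lra.
  - field; lra.
Qed.

Lemma slant_helix_form : exists (a A B : R) (theta : R -> R) (M : mat3),
  a <> 0 /\ A ^ 2 + B ^ 2 = 1 /\ smooth_on lo hi theta /\ is_rotation M /\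
  forall s, I s -> mulmv M (alpha s) = helix_curve a A B theta s.
Proof.
  destruct axis_r as [Hr Hr2].
  destruct (ooint_inhabited lo hi Hlohi) as [s0 Hs0].
  destruct (e1_unit s0 Hs0) as [E11 E1e].
  (* The constants and the first row are frozen at a base point; the rows map [e] to the vertical
     axis. *)
  exists a, (Aof s0), (Bof s0), theta, (M3 (e1 s0) (cross e (e1 s0)) e).
  split; [|split; [|split; [|split]]].
  - apply Rmult_integral_contrapositive_currified; auto; apply Rinv_neq_0_compat; lra.
  - pose proof (frame_dot _ _ _ (alpha s0) (alpha s0) (Hframe s0 Hs0)) as H.
    rewrite (Hsphere s0 Hs0), (dot_alpha_T s0 Hs0) in H.
    assert (Hpq : p s0 ^ 2 + q s0 ^ 2 = 1) by (unfold p, q; rewrite H; ring).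
    rewrite <- Hpq; unfold Aof, Bof; ring [(cos2_eq (b s0 / c))].
  - exact theta_smooth.
  - assert (H := oriented_frame_intro (e1 s0) e E11 He E1e).
    (* [H7] reduces the determinant to the squared norm of [e1 s0]. *)
    destruct H as ((H1 & H2 & H3) & (H4 & H5 & H6) & (H7 & _ & _)).
    repeat split; auto; unfold det3; simpl; rewrite H7; auto.
  - intros s Hs; rewrite helix_curveE.
    (* The constants are moved to the current point, where [helix_p] and [helix_q] invert the
       rotation and return [p s] and [q s]. *)
    destruct (Aof_Bof_const s0 s Hs0 Hs) as [-> ->].
    assert (Hph : sin (theta s) / a = b s / c).
    { rewrite (sin_theta s Hs); unfold a; field; lra. }
    replace (helix_p a (Aof s) (Bof s) (theta s)) with (p s).
    replace (helix_q a (Aof s) (Bof s) (theta s)) with (q s).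
    + rewrite <- (alpha_coordinates s Hs), (e1_const s s0); auto.
    + unfold helix_q, Aof, Bof; rewrite Hph; ring [(cos2_eq (b s / c))].
    + unfold helix_p, Aof, Bof; rewrite Hph; ring [(cos2_eq (b s / c))].
Qed.

End SphericalSlantHelix.

Lemma spherical_slant_helix_form (lo hi : Rbar) (alpha : R -> vec3) :
  Rbar_lt lo hi -> is_spherical_slant_helix lo hi alpha ->
  exists (a A B : R) (theta : R -> R) (M : mat3),
    a <> 0 /\ A ^ 2 + B ^ 2 = 1 /\ smooth_on lo hi theta /\ is_rotation M /\
    forall s, ooint lo hi s -> mulmv M (alpha s) = helix_curve a A B theta s.
Proof.
  intros Hlohi ((Hsm & Hreg & Hcurv & e & c & He1 & Hc & HN) & Hsph).
  pose proof (vnorm_eq1 e He1) as He.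
  pose proof (frenet_frame lo hi alpha Hreg Hcurv) as HF.
  pose proof (frenet_equations lo hi alpha Hsm Hreg Hcurv) as HE.
  (* Stated for any axis with positive binormal component, to be used with [e] or with its
     opposite. *)
  assert (Hform : forall e' c', dot e' e' = 1 -> c' <> 0 ->
    (forall s, ooint lo hi s -> dot (normal alpha s) e' = c') ->
    (forall s, ooint lo hi s -> 0 < dot e' (binormal alpha s)) ->
    exists (a A B : R) (theta : R -> R) (M : mat3),
      a <> 0 /\ A ^ 2 + B ^ 2 = 1 /\ smooth_on lo hi theta /\ is_rotation M /\
      forall s, ooint lo hi s -> mulmv M (alpha s) = helix_curve a A B theta s).
  { intros e' c' He' Hc' HN' Hb'.
    apply (slant_helix_form lo hi alpha (tangent alpha) (normal alpha) (binormal alpha) e' c');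
      auto.
    - intros s Hs; destruct (velocity_tangent lo hi alpha Hreg s Hs) as [E Hv].
      exists (speed alpha s); split; [lra|]; rewrite <- E.
      now apply (smooth_curve_is_vderive lo hi).
    - now apply tangent_smooth.
    - intros s Hs; now apply vnorm_eq1, Hsph. }
  assert (Hu : forall s, ooint lo hi s -> exists m t, 0 < m /\
    is_derive (fun x => dot e (tangent alpha x)) s (m * c) /\
    is_derive (fun x => dot e (binormal alpha x)) s (- t * c) /\
    m * dot e (tangent alpha s) = t * dot e (binormal alpha s)).
  { intros s Hs; destruct (HE s Hs) as (m & t & Hm & DT & DN & DB).
    assert (E0 : forall v, dot vzero v = 0) by vec_ring.
    exists m, t; split; [exact Hm | split; [|split]].
    - eapply is_derive_eq; [apply is_derive_dot; [apply is_vderive_const | exact DT]|].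
      rewrite E0, dot_vscale_r, (dot_comm e), (HN s Hs); ring.
    - eapply is_derive_eq; [apply is_derive_dot; [apply is_vderive_const | exact DB]|].
      rewrite E0, dot_vscale_r, (dot_comm e), (HN s Hs); ring.
    - pose proof (dot_const_derive lo hi (normal alpha) (fun _ => e) s _ _ c HN Hs DN
                    (is_vderive_const e s)) as H.
      rewrite dot_vadd_l, !dot_vscale_l, (dot_comm (normal alpha s) vzero), E0,
        (dot_comm (tangent alpha s)), (dot_comm (binormal alpha s)) in H; lra. }
  assert (Hsum : forall s, ooint lo hi s ->
    dot e (tangent alpha s) ^ 2 + c ^ 2 + dot e (binormal alpha s) ^ 2 = 1).
  { intros s Hs; pose proof (frame_dot _ _ _ e e (HF s Hs)) as H.
    rewrite He, (dot_comm e (normal alpha s)), (HN s Hs) in H; rewrite H; ring. }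
  assert (Hb0 : forall s, ooint lo hi s -> dot e (binormal alpha s) <> 0).
  { (* A zero forces [e = +-N] there, so [c ^ 2 = 1], so [<e, T> = 0] throughout,
       against its derivative [m c]. *)
    intros s Hs Hb; destruct (Hu s Hs) as (m & t & Hm & DT & _ & E).
    assert (Hu0 : dot e (tangent alpha s) = 0).
    { apply Rmult_eq_reg_l with m; [rewrite E, Hb; ring | lra]. }
    pose proof (Hsum s Hs) as Hc1; rewrite Hb, Hu0 in Hc1.
    assert (Hconst : is_derive (fun x => dot e (tangent alpha x)) s 0).
    { apply (is_derive_ext_loc (fun _ => 0)); [|apply @is_derive_const].
      apply (filter_imp (ooint lo hi)); [|now apply ooint_locally].
      intros x Hx; specialize (Hsum x Hx); nra. }
    apply is_derive_unique in DT; apply is_derive_unique in Hconst.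
    assert (m * c <> 0) by (apply Rmult_integral_contrapositive_currified; lra).
    congruence. }
  destruct (nonvanishing_sign lo hi (fun x => dot e (binormal alpha x))) as [Hb|Hb]; auto.
  - intros s Hs; destruct (Hu s Hs) as (m & t & _ & _ & DB & _); eexists; exact DB.
  - now apply (Hform e c).
  (* Reversing the axis also changes the sign of the constant, hence of the parameter [a] obtained
     from it. *)
  - apply (Hform (vscale (-1) e) (- c)).
    + rewrite dot_vscale_l, dot_vscale_r, He; ring.
    + lra.
    + intros s Hs; rewrite dot_vscale_r, (HN s Hs); ring.
    + intros s Hs; rewrite dot_vscale_l; specialize (Hb s Hs); simpl in Hb; lra.
Qed.

Theorem theorem4p1 (lo hi : Rbar) (hlohi : Rbar_lt lo hi) :
  (forall (a A B : R) (theta : R -> R),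
      a <> 0 ->
      A ^ 2 + B ^ 2 = 1 ->
      smooth_on lo hi theta ->
      regular_on lo hi (helix_curve a A B theta) ->
      is_spherical_slant_helix lo hi (helix_curve a A B theta))
  /\
  (forall alpha : R -> vec3,
      is_spherical_slant_helix lo hi alpha ->
      exists (a A B : R) (theta : R -> R) (M : mat3),
        a <> 0 /\
        A ^ 2 + B ^ 2 = 1 /\
        smooth_on lo hi theta /\
        is_rotation M /\
        forall s : R, ooint lo hi s ->
          mulmv M (alpha s) = helix_curve a A B theta s).
Proof.
  split.
  - intros a A B theta; now apply helix_is_spherical_slant_helix.
  - intros alpha; now apply spherical_slant_helix_form.
Qed.
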